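(* Let $G$ be a ${\rm b}^{\ast}$-monotonic graph of girth greater than four such that no two distinct 5-cycles of $G$ intersect in a path of length two. Then ${\rm b}^{\ast}(G)=m^{\ast}(G)+1$.
   Context: Graphs are finite, simple, undirected; $d(v)$ is the degree and $N(v)$ the neighbourhood of $v$; the girth is the length of a shortest cycle (infinite for forests). For a proper coloring $c:V(G)\to\{1,\dots,k\}$, a vertex $u$ is a b-vertex if every color $j\in\{1,\dots,k\}\setminus\{c(u)\}$ appears on a neighbour of $u$. A ${\rm b}^{\ast}$-coloring with $k$ colors is a proper coloring $c:V(G)\to\{1,\dots,k\}$ containing a b-vertex $u$ with $c(u)=k$ such that for each $j<k$, $u$ is adjacent to a b-vertex of color $j$; ${\rm b}^{\ast}(G)$ is the maximum $k$ for which $G$ has such a coloring. $G$ is ${\rm b}^{\ast}$-monotonic if ${\rm b}^{\ast}(H_2)\le{\rm b}^{\ast}(H_1)$ for every induced subgraph $H_1$ of $G$ and every induced subgraph $H_2$ of $H_1$. $m^{\ast}(G)$ is the maximum $k\ge0$ such that there exist $u\in V(G)$ and distinct $u_1,\dots,u_k\in N(u)$ with $d(u_i)\ge k$ for all $i$. *)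

(* Defs.v *)
From mathcomp Require Import all_boot.

Set Implicit Arguments.
Unset Strict Implicit.
Unset Printing Implicit Defensive.

Record sgraph := SGraph {
  vertex :> finType;
  adj : rel vertex;
  adj_sym : symmetric adj;
  adj_irr : irreflexive adj
}.

Definition neigh (G : sgraph) (v : G) : {set G} := [set w | adj v w].

Definition deg (G : sgraph) (v : G) : nat := #|neigh v|.

Section Induced.
Variables (G : sgraph) (A : {set G}).

Definition induced_vertex : finType := {x : G | x \in A}.

Definition induced_adj : rel induced_vertex :=
  fun x y => adj (val x) (val y).

Fact induced_adj_sym : symmetric induced_adj.
Proof. by move=> x y; apply: adj_sym. Qed.

Fact induced_adj_irr : irreflexive induced_adj.
Proof. by move=> x; apply: adj_irr. Qed.

Definition induced : sgraph := SGraph induced_adj_sym induced_adj_irr.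
End Induced.

(* The k colours are the elements of 'I_k: the colour j of {1, ..., k} is
   represented by the ordinal of value j - 1. *)
Definition proper_coloring (G : sgraph) (k : nat) (c : {ffun G -> 'I_k}) : bool :=
  [forall u, forall v, adj u v ==> (c u != c v)].

Definition b_vertex (G : sgraph) (k : nat) (c : {ffun G -> 'I_k}) (u : G) : bool :=
  [forall j : 'I_k, (j != c u) ==> [exists v, adj u v && (c v == j)]].

Definition bstar_coloring (G : sgraph) (k : nat) (c : {ffun G -> 'I_k}) : bool :=
  proper_coloring c &&
  [exists u : G, [&& b_vertex c u, (c u).+1 == k &
    [forall j : 'I_k, (j.+1 < k) ==>
      [exists v, [&& adj u v, c v == j & b_vertex c v]]]]].

Definition bstar_colorable (G : sgraph) (k : nat) : bool :=
  [exists c : {ffun G -> 'I_k}, bstar_coloring c].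

(* The bound on k is harmless, see leq_bstar; the value is 0 for the graph
   without vertices, which has no such coloring. *)
Definition bstar (G : sgraph) : nat :=
  \max_(k < #|G|.+1 | bstar_colorable G k) k.

Lemma leq_bstar (G : sgraph) (k : nat) : bstar_colorable G k -> k <= bstar G.
Proof.
move=> Gk; have k_le : k < #|G|.+1.
  case/existsP: (Gk) => c /andP[_ /existsP[u /and3P[/forallP bu _ _]]].
  have c_onto (j : 'I_k) : j \in codom c.
    have := bu j; case: eqVneq => [-> _|_ /existsP[v /andP[_ /eqP <-]]];
      exact: codom_f.
  have: #|'I_k| <= #|codom c| by apply: subset_leq_card; apply/subsetP.
  by rewrite card_ord ltnS => /leq_trans; apply; apply: leq_image_card.
exact: (@leq_bigmax_cond _ _ (fun i : 'I_#|G|.+1 => i : nat) (Ordinal k_le)).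
Qed.

Definition bstar_monotonic (G : sgraph) : Prop :=
  forall A B : {set G}, B \subset A -> bstar (induced B) <= bstar (induced A).

Definition mstar_witness (G : sgraph) (k : nat) : bool :=
  [exists u : G, exists S : {set G},
    [&& S \subset neigh u, #|S| == k & [forall v in S, k <= deg v]]].

(* Again 0 for the graph without vertices. *)
Definition mstar (G : sgraph) : nat :=
  \max_(k < #|G|.+1 | mstar_witness G k) k.

Lemma leq_mstar (G : sgraph) (k : nat) : mstar_witness G k -> k <= mstar G.
Proof.
move=> Gk; have k_le : k < #|G|.+1.
  case/existsP: (Gk) => u /existsP[S /and3P[_ /eqP <- _]].
  by rewrite ltnS max_card.
exact: (@leq_bigmax_cond _ _ (fun i : 'I_#|G|.+1 => i : nat) (Ordinal k_le)).
Qed.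

(* A cycle is given by a list of its vertices in cyclic order. *)
Definition is_cycle (G : sgraph) (n : nat) (c : seq G) : bool :=
  [&& 2 < n, size c == n & ucycleb (@adj G) c].

Definition has_cycle (G : sgraph) (n : nat) : bool :=
  [exists c : n.-tuple G, is_cycle n c].

(* The least length of a cycle; None is the infinite girth of a forest. *)
Definition girth (G : sgraph) : option nat :=
  ohead [seq n <- iota 0 #|G|.+1 | has_cycle G n].

Definition girth_gt (G : sgraph) (g : nat) : bool :=
  if girth G is Some n then g < n else true.

Lemma girth_gtP (G : sgraph) (g : nat) :
  reflect (forall n (c : seq G), is_cycle n c -> g < n) (girth_gt G g).
Proof.
rewrite /girth_gt /girth; set s := [seq _ <- _ | _].
have s_sorted : sorted ltn s.
  by apply: sorted_filter; [apply: ltn_trans | apply: iota_ltn_sorted].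
have mem_s n (c : seq G) : is_cycle n c -> n \in s.
  move=> cn; case/and3P: (cn) => _ /eqP sz_c /andP[_ Uc].
  rewrite mem_filter mem_iota /= add0n ltnS -{2}sz_c -(card_uniqP Uc) max_card.
  rewrite andbT; apply/existsP; have/eqP sz_c' := sz_c.
  by exists (Tuple sz_c').
have s_cycle n : n \in s -> exists c : seq G, is_cycle n c.
  by rewrite mem_filter => /andP[/existsP[c cn] _]; exists c.
case: s s_sorted mem_s s_cycle => [|m s] s_sorted mem_s s_cycle /=.
  by apply: ReflectT => n c /mem_s.
apply: (iffP idP) => [g_lt n c /mem_s|].
  rewrite inE => /predU1P[-> //|n_s]; apply: ltn_trans g_lt _.
  by move: s_sorted => /= /(order_path_min ltn_trans)/allP; apply.
by have [c cm] := s_cycle m (mem_head _ _); move/(_ m c cm).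
Qed.

Definition cycle_verts (G : sgraph) (c : seq G) : {set G} := [set x in c].

Definition cycle_edges (G : sgraph) (c : seq G) : {set {set G}} :=
  [set [set x; next c x] | x in c].

(* Distinct as subgraphs: different lists may describe the same cycle. *)
Definition distinct_cycles (G : sgraph) (c1 c2 : seq G) : Prop :=
  (cycle_verts c1, cycle_edges c1) <> (cycle_verts c2, cycle_edges c2).

(* The intersection of the two subgraphs is the path with vertices x, y, z and
   edges xy, yz. *)
Definition meet_in_path2 (G : sgraph) (c1 c2 : seq G) : Prop :=
  exists x y z : G,
    [/\ uniq [:: x; y; z],
        cycle_verts c1 :&: cycle_verts c2 = [set x; y; z] &
        cycle_edges c1 :&: cycle_edges c2 = [set [set x; y]; [set y; z]]].

(* Main.v *)
Require Import Defs.
From mathcomp Require Import all_boot zify.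

Set Implicit Arguments.
Unset Strict Implicit.
Unset Printing Implicit Defensive.

(** The neighbours of the centre of a b*-coloring with k colors witness
    m* >= k - 1.  Conversely, let S be a set of m neighbours of u, each of
    degree at least m, and let W v consist of m - 1 neighbours of v other than
    u, for v in S.  By monotonicity it suffices to color the subgraph induced by
    u, S and the sets W v with the palette S + u: u and the vertices of S color
    themselves, and W v is mapped onto S - v.  The girth condition leaves only
    edges between distinct sets W v and W v' to worry about.  The condition on
    5-cycles says that each vertex lies on at most one such edge and that there
    is at most one such edge for each pair v, v'; so the ends of this edge can
    be colored v' and v respectively. *)

(** * Subsets and surjections of finite sets *)

Lemma exists_subset_card (T : finType) (A : {set T}) n :
  n <= #|A| -> exists2 B : {set T}, B \subset A & #|B| = n.
Proof.
case/card_geqP=> s [Us sz_s sA]; exists [set x in s].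
  by apply/subsetP=> x; rewrite inE => /sA.
by rewrite cardsE (card_uniqP Us).
Qed.

(** Injectivity of [h] on [D] leaves [A :\: D] and [B :\: h @: D] equally large, so their
    enumerations can be matched position by position. This lets prescribed colors on some vertices
    be completed so that every color still occurs. *)
Lemma extend_to_surjection (T : finType) (A B D : {set T}) (h : T -> T) :
    D \subset A -> {in D, forall x, h x \in B} -> {in D &, injective h} ->
    #|A| = #|B| ->
  exists f : T -> T, [/\ {in A, forall x, f x \in B},
    forall y, y \in B -> exists2 x, x \in A & f x = y & {in D, f =1 h}].
Proof.
move=> sDA hB hI cAB; pose A' := enum (A :\: D).
pose B' := enum (B :\: h @: D).
have hDB : h @: D \subset B by apply/subsetP=> _ /imsetP[x Dx ->]; apply: hB.
have szAB : size A' = size B'.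
  rewrite -!cardE !cardsD (setIidPr sDA) (setIidPr hDB) card_in_imset //.
  by rewrite cAB.
exists (fun x => if x \in D then h x else nth x B' (index x A')); split.
- move=> x Ax /=; case: ifPn => [/hB //|nDx].
  have: nth x B' (index x A') \in B'.
    by rewrite mem_nth // -szAB index_mem mem_enum inE nDx.
  by rewrite mem_enum inE => /andP[].
- move=> y By; have [/imsetP[x Dx ->]|nhy] := boolP (y \in h @: D).
    by exists x; [apply: (subsetP sDA) | rewrite Dx].
  have B'y : y \in B' by rewrite mem_enum inE nhy.
  have lt_y : index y B' < size A' by rewrite szAB index_mem.
  exists (nth y A' (index y B')).
    by have := mem_nth y lt_y; rewrite mem_enum inE => /andP[].
  have:= mem_nth y lt_y; rewrite mem_enum inE => /andP[/negPf-> _].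
  rewrite index_uniq ?enum_uniq //.
  by rewrite (set_nth_default y) ?nth_index // index_mem.
- by move=> x /= ->.
Qed.

(** * Short cycles *)

Lemma no_triangle (G : sgraph) (x y z : G) :
  girth_gt G 4 -> adj x y -> adj y z -> adj z x -> False.
Proof.
move=> /girth_gtP gG xy yz zx; have /gG // : is_cycle 3 [:: x; y; z].
apply/and3P; split => //; apply/andP; split; first by rewrite /= xy yz zx.
rewrite /= !inE andbT negb_or; apply/andP; split; first (apply/andP; split).
- by apply: contraTneq xy => ->; rewrite adj_irr.
- by apply: contraTneq zx => ->; rewrite adj_irr.
- by apply: contraTneq yz => ->; rewrite adj_irr.
Qed.

(** Adjacent vertices differ anyway, so once [x != z] only [y = t] can keep the closed walk from
    being a 4-cycle. *)
Lemma square_degenerate (G : sgraph) (x y z t : G) :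
    girth_gt G 4 -> adj x y -> adj y z -> adj z t -> adj t x -> x != z ->
  y = t.
Proof.
move=> /girth_gtP gG xy yz zt tx xz; apply/eqP/negPn/negP => yt.
have /gG // : is_cycle 4 [:: x; y; z; t].
apply/and3P; split => //; apply/andP; split; first by rewrite /= xy yz zt tx.
rewrite /= !inE !negb_or xz yt !andbT.
have ne (a b : G) : adj a b -> a != b.
  by move=> ab; apply: contraTneq ab => ->; rewrite adj_irr.
by rewrite !ne // adj_sym.
Qed.

Lemma cycle5_edges (G : sgraph) (a b c d e : G) :
    uniq [:: a; b; c; d; e] ->
  cycle_edges [:: a; b; c; d; e] =
    [set s in [:: [set a; b]; [set b; c]; [set c; d]; [set d; e]; [set e; a]]].
Proof.
move=> U; apply/setP=> s; rewrite inE.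
have nextE : [seq [set x; next [:: a; b; c; d; e] x] | x <- [:: a; b; c; d; e]]
    = [:: [set a; b]; [set b; c]; [set c; d]; [set d; e]; [set e; a]].
  move: U; rewrite /= !inE !negb_or -!andbA !andbT.
  case/and5P=> /negPf ab /negPf ac /negPf ad /negPf ae.
  case/and5P=> /negPf bc /negPf bd /negPf be /negPf cd.
  case/andP=> /negPf ce /negPf de.
  rewrite !eqxx (eq_sym b a) (eq_sym c a) (eq_sym c b) (eq_sym d a).
  rewrite (eq_sym d b) (eq_sym d c) (eq_sym e a) (eq_sym e b) (eq_sym e c).
  by rewrite (eq_sym e d) ab ac ad ae bc bd be cd ce de.
rewrite -nextE; apply/imsetP/mapP => [] [x cx ->]; exists x => //.
Qed.

(** If the seven vertices were distinct, the two 5-cycles would meet exactly in the path [a], [b],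
    [c]: every other edge of the first one contains [d] or [e], which lie off the second. *)
Lemma no_two_cycle5_on_path2 (G : sgraph) (a b c d e d' e' : G) :
    (forall c1 c2 : seq G, is_cycle 5 c1 -> is_cycle 5 c2 ->
      distinct_cycles c1 c2 -> ~ meet_in_path2 c1 c2) ->
    adj a b -> adj b c -> adj c d -> adj d e -> adj e a ->
    adj c d' -> adj d' e' -> adj e' a ->
  ~~ uniq [:: a; b; c; d; e; d'; e'].
Proof.
move=> C5 ab bc cd de ea cd' de' ea'; apply/negP=> U.
have U1 : uniq [:: a; b; c; d; e].
  by move: U; rewrite -[_ :: _]/([:: a; b; c; d; e] ++ _) cat_uniq => /andP[].
have U2 : uniq [:: a; b; c; d'; e'].
  apply: subseq_uniq U; rewrite -[X in subseq X]/([:: a; b; c] ++ [:: d'; e']).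
  by apply: cat_subseq (subseq_refl _) (suffix_subseq [:: d; e] _).
have [dN eN] : d \notin [:: a; b; c; d'; e'] /\ e \notin [:: a; b; c; d'; e'].
  have/perm_uniq/esym : perm_eq [:: a; b; c; d; e; d'; e']
      ([:: d; e] ++ [:: a; b; c; d'; e']).
    by rewrite -[X in perm_eq X]/([:: a; b; c] ++ [:: d; e] ++ [:: d'; e'])
         perm_catCA.
  rewrite U => /= /and3P[]; rewrite inE negb_or => /andP[_ ->] -> _.
  by [].
have edge_mem s x : s \in cycle_edges [:: a; b; c; d'; e'] -> x \in s ->
    x \in [:: a; b; c; d'; e'].
  rewrite cycle5_edges // !inE => /or4P[|||/orP[]] /eqP->;
    by rewrite !inE => /orP[] ->; rewrite ?orbT.
apply: (C5 [:: a; b; c; d; e] [:: a; b; c; d'; e']).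
- by rewrite /is_cycle /ucycleb U1 /= ab bc cd de ea.
- by rewrite /is_cycle /ucycleb U2 /= ab bc cd' de' ea'.
- case=> /setP/(_ d) /esym; rewrite !inE eqxx !orbT => E _.
  by move: dN; rewrite !inE E.
- exists a, b, c; split.
  + by move: U; rewrite -[_ :: _]/([:: a; b; c] ++ _) cat_uniq => /andP[].
  + apply/setP=> x; rewrite !inE; apply/andP/idP => [[]|]; last first.
      by case/orP=> [/orP[]|] ->; rewrite ?orbT.
    rewrite -orbA => /or4P[->|->|->|/orP[]/eqP->]; rewrite ?orbT //.
      by move: dN; rewrite !inE => /negPf->.
    by move: eN; rewrite !inE => /negPf->.
  + apply/setP=> s; rewrite [LHS]inE; apply/andP/idP => [[s1 s2]|]; last first.
      by rewrite !cycle5_edges // !inE => /orP[] ->; rewrite ?orbT.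
    have sN x : x \notin [:: a; b; c; d'; e'] -> x \notin s.
      by apply: contra; apply: edge_mem.
    have := sN d dN; have := sN e eN.
    move: s1; rewrite cycle5_edges // !inE.
    by case/or4P=> [->|->|/eqP->|/orP[]/eqP->]; rewrite ?inE ?eqxx ?orbT.
Qed.

(** * Transfer of colorings *)

(** Allows vertices themselves to serve as colors. A label becomes its position in [rcons p a], with
    [a] last because the center must carry the top color. The center is a b-vertex automatically, as
    its neighbors show all labels of [p]. *)
Lemma bstar_colorable_labels (G : sgraph) (T : eqType) (p : seq T) (a : T)
    (c : G -> T) (u : G) :
    uniq (rcons p a) -> (forall x, c x \in rcons p a) ->
    (forall x y, adj x y -> c x != c y) -> c u = a ->
    {in p, forall b, exists v, [/\ adj u v, c v = b &
      forall d, d \in rcons p a -> d != b -> exists2 w, adj v w & c w = d]} ->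
  bstar_colorable G (size p).+1.
Proof.
move=> Up cP cN cu bP.
pose g x : 'I_(size p).+1 := inord (index (c x) (rcons p a)).
have gE x : g x = index (c x) (rcons p a) :> nat.
  by rewrite /g inordK // -(size_rcons p a) index_mem.
have gI x y : g x = g y -> c x = c y.
  move/(congr1 (@nat_of_ord _)); rewrite !gE.
  by move/(congr1 (nth a (rcons p a))); rewrite !nth_index.
have lblE (j : 'I_(size p).+1) x : c x = nth a (rcons p a) j -> g x = j.
  by move=> cx; apply: val_inj; rewrite /= gE cx index_uniq // size_rcons.
have lblP (j : 'I_(size p).+1) : nth a (rcons p a) j \in rcons p a.
  by rewrite mem_nth // size_rcons.
have gu : g u = size p :> nat.
  move: Up; rewrite gE cu rcons_uniq => /andP[/negPf a_p _].
  by rewrite -cats1 index_cat a_p /= eqxx addn0.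
apply/existsP; exists [ffun x => g x]; apply/andP; split.
  apply/forallP=> x; apply/forallP=> y; apply/implyP=> /cN; rewrite !ffunE.
  by apply: contra_neq; apply: gI.
apply/existsP; exists u; apply/and3P; split.
- apply/forallP=> j; apply/implyP; rewrite ffunE => nj.
  have [lt_j|] := ltnP j (size p).
    have /bP[v [uv cv _]] : nth a (rcons p a) j \in p.
      by rewrite nth_rcons lt_j mem_nth.
    by apply/existsP; exists v; rewrite uv ffunE (lblE _ _ cv) eqxx.
  move=> le_j; case/eqP: nj; apply: val_inj => /=; rewrite gu.
  by apply/eqP; rewrite eqn_leq le_j andbT -ltnS ltn_ord.
- by rewrite ffunE gu.
- apply/forallP=> j; apply/implyP; rewrite ltnS => lt_j.
  have /bP[v [uv cv bv]] : nth a (rcons p a) j \in p.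
    by rewrite nth_rcons lt_j mem_nth.
  have gv : g v = j by apply: lblE.
  apply/existsP; exists v; rewrite uv ffunE gv eqxx /=.
  apply/forallP=> i; apply/implyP; rewrite ffunE gv => nij.
  have [||w vw cw] := bv (nth a (rcons p a) i); first exact: lblP.
    by rewrite nth_uniq ?size_rcons.
  by apply/existsP; exists w; rewrite vw ffunE (lblE _ _ cw) eqxx.
Qed.

(** Monotonicity compares induced subgraphs with one another; this links them to [G] itself. *)
Lemma bstar_induced_setT (G : sgraph) : bstar (induced [set: G]) <= bstar G.
Proof.
apply/bigmax_leqP => k /existsP[c /andP[/forallP cP /existsP[u]]].
case/and3P=> /forallP bu /eqP cu /forallP nu.
pose i (x : G) : induced [set: G] := exist _ x (in_setT x).
have iK x : i (val x) = x by apply: val_inj.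
have bE v : b_vertex c v -> b_vertex [ffun x => c (i x)] (val v).
  move/forallP=> bv; apply/forallP=> j; rewrite ffunE iK.
  apply/implyP=> /(implyP (bv j))/existsP[w /andP[vw cw]].
  by apply/existsP; exists (val w); rewrite ffunE iK cw andbT.
apply: leq_bstar; apply/existsP; exists [ffun x => c (i x)].
apply/andP; split.
  apply/forallP=> x; apply/forallP=> y; rewrite !ffunE.
  exact: (forallP (cP (i x)) (i y)).
apply/existsP; exists (val u); rewrite bE ?ffunE ?iK ?cu ?eqxx /=; last first.
  exact/forallP.
apply/forallP=> j; apply/implyP=> /(implyP (nu j))/existsP[v /and3P[uv cv bv]].
apply/existsP; exists (val v); apply/and3P.
by split; [exact: uv | rewrite ffunE iK | apply: bE].
Qed.

(** * The upper bound *)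

Lemma bstar_leq_mstar (G : sgraph) : bstar G <= mstar G + 1.
Proof.
apply/bigmax_leqP => k /existsP[c /andP[/forallP cP /existsP[u]]].
case/and3P=> /forallP bu /eqP cu /forallP nu.
case: (nat_of_ord k) c cP bu cu nu => [|m] c cP bu cu nu; first by [].
rewrite addn1 ltnS; apply: leq_mstar; apply/existsP; exists u.
have deg_b v : b_vertex c v -> m <= deg v.
  move/forallP=> bv; have sub : [set~ c v] \subset c @: neigh v.
    apply/subsetP=> j; rewrite !inE => /(implyP (bv j))/existsP[w /andP[vw]].
    by move/eqP<-; apply: imset_f; rewrite inE.
  apply: leq_trans (leq_imset_card c _); apply: leq_trans (subset_leq_card sub).
  by rewrite cardsC1 card_ord.
pose B := [set v in neigh u | b_vertex c v].
have mB : m <= #|B|.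
  have sub : [set~ c u] \subset c @: B.
    apply/subsetP=> j; rewrite !inE => nj; have /(implyP (nu j)) : j.+1 < m.+1.
      (* The center has the top color, of value [m], so [j != c u] forces [j < m]. *)
      rewrite ltnS ltn_neqAle -ltnS ltn_ord andbT.
      apply: contraNneq nj => /= jm; apply/eqP/val_inj.
      by rewrite /= jm; case: cu.
    case/existsP=> v /and3P[uv /eqP<- bv]; apply: imset_f.
    by rewrite !inE uv.
  apply: leq_trans (leq_imset_card c _); apply: leq_trans (subset_leq_card sub).
  by rewrite cardsC1 card_ord.
have [S SB cS] := exists_subset_card mB.
apply/existsP; exists S; rewrite cS eqxx /=; apply/andP; split.
  by apply: subset_trans SB _; apply/subsetP=> v; rewrite inE => /andP[].
by apply/forall_inP=> v /(subsetP SB); rewrite inE => /andP[_ /deg_b].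
Qed.

(** * The lower bound *)

(** A vertex together with the empty set witnesses 0, so the maximum is attained. Without vertices,
    [mstar] and [bstar] are both 0 by default and the theorem would fail. *)
Lemma mstar_witness_mstar (G : sgraph) : 0 < #|G| -> mstar_witness G (mstar G).
Proof.
case/card_gt0P=> u _; pose P := [pred k : 'I_#|G|.+1 | mstar_witness G k].
have P0 : 0 < #|P|.
  apply/card_gt0P; exists ord0; apply/existsP; exists u; apply/existsP.
  exists set0; rewrite sub0set cards0 eqxx /=.
  by apply/forall_inP => v; rewrite inE.
by have [k Pk] := eq_bigmax_cond (fun k : 'I_#|G|.+1 => k : nat) P0;
   rewrite /mstar => ->.
Qed.

Lemma mstar_lt_bstar (G : sgraph) :
    0 < #|G| -> bstar_monotonic G -> girth_gt G 4 ->
    (forall c1 c2 : seq G, is_cycle 5 c1 -> is_cycle 5 c2 ->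
      distinct_cycles c1 c2 -> ~ meet_in_path2 c1 c2) ->
  mstar G < bstar G.
Proof.
move=> G0 mono gG C5; set m := mstar G.
have /existsP[u /existsP[S]] : mstar_witness G m by apply: mstar_witness_mstar.
case/and3P=> /subsetP SN /eqP cS /forall_inP Sdeg.
have uS v : v \in S -> adj u v by move/SN; rewrite inE.
have nSu : u \notin S by apply/negP=> /uS; rewrite adj_irr.
have /fin_all_exists[W WP] v : exists Wv : {set G}, v \in S ->
    Wv \subset neigh v :\ u /\ #|Wv| = #|S :\ v|.
  have [Sv|nSv] := boolP (v \in S); last by exists set0.
  have le : #|S :\ v| <= #|neigh v :\ u|.
    have:= Sdeg v Sv; rewrite -cS (cardsD1 v) Sv /deg (cardsD1 u (neigh v)).
    by rewrite inE adj_sym uS.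
  by have [B] := exists_subset_card le; exists B.
have vW v w : v \in S -> w \in W v -> adj v w.
  by move=> /WP[/subsetP sW _] /sW; rewrite !inE => /andP[].
have uW v w : v \in S -> w \in W v -> w != u.
  by move=> /WP[/subsetP sW _] /sW; rewrite !inE => /andP[].
have WS v w : v \in S -> w \in W v -> w \notin S.
  move=> Sv Ww; apply/negP=> Sw.
  by apply: (no_triangle gG (uS v Sv) (vW _ _ Sv Ww)); rewrite adj_sym uS.
(* Otherwise [u], [v], [w], [v'] would form a 4-cycle. Hence the only neighbor in [S] of a vertex of
   [W v] is [v], and the sets [W v] are pairwise disjoint. *)
have SWu v v' w : v \in S -> v' \in S -> w \in W v -> adj v' w -> v = v'.
  move=> Sv Sv' Ww v'w; apply: (square_degenerate gG (x := u) (z := w)).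
  - exact: uS.
  - exact: vW Ww.
  - by rewrite adj_sym.
  - by rewrite adj_sym uS.
  - by rewrite eq_sym (uW v).
have WWu v v' w : v \in S -> v' \in S -> w \in W v -> w \in W v' -> v = v'.
  by move=> Sv Sv' Ww Ww'; apply: (SWu v v' w) => //; apply: vW.
have Su v : v \in S -> adj v u by rewrite adj_sym; apply: uS.
have Wv v w : v \in S -> w \in W v -> adj w v by rewrite adj_sym; apply: vW.
have WO v w : v \in S -> w \in W v -> w \notin u |: S.
  by move=> Sv Ww; rewrite !inE negb_or (uW v) // (WS v).
have neW v v' w w' : v \in S -> v' \in S -> v != v' ->
    w \in W v -> w' \in W v' -> w != w'.
  move=> Sv Sv' nvv' Ww Ww'; apply: contra_neq nvv' => ww'.
  by apply: (WWu _ _ w) => //; rewrite ww'.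
have layers_uniq s t : all [in S] s -> all [predC u |: S] t ->
    uniq s -> uniq t -> uniq (u :: s ++ t).
  move=> /allP sS /allP tN Us Ut; rewrite /= cat_uniq Us Ut andbT mem_cat.
  rewrite negb_or (contra (sS u)) //=; apply/andP; split.
    by apply/negP=> /tN; rewrite !inE eqxx.
  by apply/hasPn=> x /tN; apply: contra => /sS /= Sx; rewrite !inE Sx orbT.
(* For [w] in [W v], an edge from [w] into another set [W v']: the only kind of edge that can spoil
   properness. *)
pose link v w v' := [&& v' \in S, v' != v & [exists w' in W v', adj w w']].
(* Two links of [w] would give the 5-cycles [u v w w1 v1] and [u v w w2 v2], sharing the path
   [u v w]. *)
have link_fun v w v1 v2 : v \in S -> w \in W v ->
    link v w v1 -> link v w v2 -> v1 = v2.
  move=> Sv Ww /and3P[S1 n1 /exists_inP[w1 Ww1 a1]].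
  case/and3P=> S2 n2 /exists_inP[w2 Ww2 a2].
  apply/eqP/negPn/negP => n12.
  have/negP[] := no_two_cycle5_on_path2 C5 (uS v Sv) (vW v w Sv Ww) a1
     (Wv v1 w1 S1 Ww1) (Su v1 S1) a2 (Wv v2 w2 S2 Ww2) (Su v2 S2).
  (* Regrouping the vertices by layer ([u], then [S], then the rest) leaves distinctness to be
     checked only within each layer. *)
  have -> : uniq [:: u; v; w; w1; v1; w2; v2] =
      uniq (u :: [:: v; v1; v2] ++ [:: w; w1; w2]).
    by apply/perm_uniq/permP=> P /=; clear; lia.
  apply: layers_uniq.
  - by rewrite /= Sv S1 S2.
  - by rewrite /= (WO v w) ?(WO v1 w1) ?(WO v2 w2).
  - by rewrite /= !inE !negb_or !(eq_sym v) n1 n2 n12.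
  - have [nv1 nv2] : v != v1 /\ v != v2 by rewrite ![v == _]eq_sym.
    have nw1 := neW v v1 w w1 Sv S1 nv1 Ww Ww1.
    have nw2 := neW v v2 w w2 Sv S2 nv2 Ww Ww2.
    have nw12 := neW v1 v2 w1 w2 S1 S2 n12 Ww1 Ww2.
    by rewrite /= !inE negb_or nw1 nw2 nw12.
(* Here the 5-cycles are [v' u v w1 w1'] and [v' u v w2 w2'], sharing the path [v' u v]; equal ends
   [w1' = w2'] would already close a 4-cycle through [v]. *)
have link_inj v w1 w2 v' : v \in S -> w1 \in W v -> w2 \in W v ->
    link v w1 v' -> link v w2 v' -> w1 = w2.
  move=> Sv W1 W2 /and3P[S' n' /exists_inP[w1' W1' a1]].
  case/and3P=> _ _ /exists_inP[w2' W2' a2].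
  apply/eqP/negPn/negP => n12.
  have n12' : w1' != w2'.
    apply: contra_neq n12 => e12; apply: (square_degenerate gG (x := v)).
    - exact: vW W1.
    - exact: a1.
    - by rewrite e12 adj_sym.
    - exact: Wv W2.
    - by apply: contraNneq (WO v' w1' S' W1') => <-; rewrite !inE Sv orbT.
  have/negP[] := no_two_cycle5_on_path2 C5 (Su v' S') (uS v Sv)
     (vW v w1 Sv W1) a1 (Wv v' w1' S' W1')
     (vW v w2 Sv W2) a2 (Wv v' w2' S' W2').
  have -> : uniq [:: v'; u; v; w1; w1'; w2; w2'] =
      uniq (u :: [:: v; v'] ++ [:: w1; w1'; w2; w2']).
    by apply/perm_uniq/permP=> P /=; clear; lia.
  have vv' : v != v' by rewrite eq_sym.
  apply: layers_uniq.
  - by rewrite /= Sv S'.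
  - by rewrite /= (WO v w1) ?(WO v w2) ?(WO v' w1') ?(WO v' w2').
  - by rewrite /= !inE vv'.
  - have nW x y := neW v v' x y Sv S' vv'.
    have n1' := nW w1 w1' W1 W1'; have n2' := nW w2 w2' W2 W2'.
    have m1 := nW w1 w2' W1 W2'; have m2 := nW w2 w1' W2 W1'.
    by rewrite /= !inE !negb_or n1' n12 m1 eq_sym m2 n12' n2'.
have /fin_all_exists[f fP] v : exists fv : G -> G, v \in S ->
   [/\ {in W v, forall w, fv w \in S :\ v},
       forall y, y \in S :\ v -> exists2 w, w \in W v & fv w = y &
       forall w v', w \in W v -> link v w v' -> fv w = v'].
  have [Sv|nSv] := boolP (v \in S); last by exists id.
  (* The color forced by a link. The default [w] is never met on the set of linked vertices, where
     [h] is injective by [link_inj]. *)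
  pose h w := odflt w [pick v' | link v w v'].
  have hE w v' : w \in W v -> link v w v' -> h w = v'.
    rewrite /h => Ww lv'; case: pickP => [v''|/(_ v')]; last by rewrite lv'.
    by move=> lv'' /=; apply: link_fun lv'' lv'.
  have hD w : w \in [set w in W v | [exists v', link v w v']] ->
    w \in W v /\ link v w (h w).
    by rewrite inE => /andP[Ww /existsP[v' lv']]; rewrite (hE w v').
  have [||||fv [f1 f2 f3]] := @extend_to_surjection _ (W v) (S :\ v)
    [set w in W v | [exists v', link v w v']] h.
  - by apply/subsetP=> w /hD[].
  - by move=> w /hD[_ /and3P[]]; rewrite !inE => -> ->.
  - move=> w1 w2 /hD[W1 l1] /hD[W2 l2] h12.
    by apply: link_inj l1 _; rewrite ?h12.
  - by case: (WP v Sv).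
  exists fv => _; split=> // w v' Ww lv'.
  by rewrite f3 ?(hE w v') // inE Ww; apply/existsP; exists v'.
(* Disjointness of the sets [W v] makes the picked [v] the right one. The value [x] outside [A] is a
   mere default, since only the subgraph induced by [A] gets colored. *)
pose col x := if (x == u) || (x \in S) then x else
  odflt x (omap (f^~ x) [pick v in S | x \in W v]).
have colu : col u = u by rewrite /col eqxx.
have colS v : v \in S -> col v = v by rewrite /col => ->; rewrite orbT.
have colW v w : v \in S -> w \in W v -> col w = f v w.
  move=> Sv Ww; rewrite /col (negPf (uW v w Sv Ww)) (negPf (WS v w Sv Ww)) /=.
  case: pickP => [v' /andP[Sv' Ww']|/(_ v)] /=; last by rewrite Sv Ww.
  by rewrite (WWu v v' w).
pose A := u |: (S :|: \bigcup_(v in S) W v).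
have AP x : x \in A -> [\/ x = u, x \in S | exists2 v, v \in S & x \in W v].
  rewrite !inE => /or3P[/eqP->|Sx|/bigcupP[v Sv Wx]]; first by constructor 1.
    by constructor 2.
  by constructor 3; exists v.
have Au : u \in A by rewrite !inE eqxx.
have AS v : v \in S -> v \in A by rewrite !inE => ->; rewrite orbT.
have AW v w : v \in S -> w \in W v -> w \in A.
  by move=> Sv Ww; rewrite !inE; apply/or3P/Or33/bigcupP; exists v.
have palE x : x \in rcons (enum S) u = (x == u) || (x \in S).
  by rewrite mem_rcons inE mem_enum.
have colWS v w : v \in S -> w \in W v -> (col w != v) && (col w \in S).
  by move=> Sv Ww; have [fS _ _] := fP v Sv; rewrite (colW v) // -in_setD1 fS.
have nadj (x y : G) : adj x y -> x != y.
  by apply: contraTneq => ->; rewrite adj_irr.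
have col_adj_u y : y \in A -> adj u y -> col y != u.
  move=> /AP[->|Sy|[v Sv Wy]] uy; first by rewrite adj_irr in uy.
    by rewrite colS // eq_sym nadj.
  have /andP[_ Scy] := colWS v y Sv Wy.
  by apply: contraNneq nSu => <-.
have col_adj_S v y : v \in S -> y \in A -> adj v y -> col y != v.
  move=> Sv /AP[->|Sy|[v' Sv' Wy]] vy.
  - by rewrite colu nadj ?uS.
  - by rewrite colS // eq_sym nadj.
  - have e := SWu v' v y Sv' Sv Wy vy; rewrite e in Wy.
    by have /andP[] := colWS v y Sv Wy.
have col_adj x y : x \in A -> y \in A -> adj x y -> col x != col y.
  move=> Ax Ay xy; have yx : adj y x by rewrite adj_sym.
  case: (AP x Ax) => [xu|Sx|[v Sv Wx]].
  - by rewrite xu colu eq_sym col_adj_u // -xu.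
  - by rewrite (colS x) // eq_sym col_adj_S.
  case: (AP y Ay) => [yu|Sy|[v' Sv' Wy]].
  - by rewrite yu colu col_adj_u // -yu.
  - by rewrite (colS y) // col_adj_S.
  have nvv' : v != v'.
    (* An edge inside [W v] would form a triangle with [v]. *)
    apply/eqP=> vv'; rewrite -vv' in Wy.
    by apply: (no_triangle gG (vW v x Sv Wx) xy); apply: Wv.
  have [_ _ fx] := fP v Sv; have [_ _ fy] := fP v' Sv'.
  (* The edge links [x] to [v'] and [y] to [v], so these are their colors, and they differ. *)
  rewrite (colW v x) // (colW v' y) // (fx x v') ?(fy y v) 1?eq_sym //.
    by rewrite /link Sv nvv'; apply/exists_inP; exists x.
  by rewrite /link Sv' eq_sym nvv'; apply/exists_inP; exists y.
suff : bstar_colorable (induced A) m.+1.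
  move/leq_bstar/leq_trans; apply.
  exact: leq_trans (mono _ _ (subsetT A)) (bstar_induced_setT G).
rewrite -cS cardE.
apply: (@bstar_colorable_labels _ _ _ u (fun x : induced A => col (val x))
         (exist _ u Au)).
- by rewrite rcons_uniq enum_uniq mem_enum nSu.
- case=> x /= /AP[->|Sx|[v Sv Wx]]; rewrite palE.
  + by rewrite colu eqxx.
  + by rewrite colS // Sx orbT.
  + by case/andP: (colWS v x Sv Wx) => _ ->; rewrite orbT.
- by case=> x Ax [y Ay] /= xy; apply: col_adj.
- by [].
- move=> v; rewrite mem_enum => Sv; exists (exist _ v (AS v Sv)).
  split=> [||d]; [exact: uS | exact: colS |].
  rewrite palE => /predU1P[-> _|Sd ndv].
    by exists (exist _ u Au) => //=; rewrite /adj /= /induced_adj adj_sym uS.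
  have [_ fO _] := fP v Sv.
  have [|w Ww fw] := fO d; first by rewrite !inE ndv.
  by exists (exist _ w (AW v w Sv Ww)); [apply: vW | rewrite /= (colW v)].
Qed.

Theorem theorem3 (G : sgraph) (G_nonempty : 0 < #|G|)
    (G_mono : bstar_monotonic G) (G_girth : girth_gt G 4)
    (G_C5 : forall c1 c2 : seq G, is_cycle 5 c1 -> is_cycle 5 c2 ->
      distinct_cycles c1 c2 -> ~ meet_in_path2 c1 c2) :
  bstar G = mstar G + 1.
Proof.
apply/eqP; rewrite eqn_leq bstar_leq_mstar addn1.
exact: mstar_lt_bstar.
Qed.
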